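(* Let $K$ be a field, let $m,n>1$, and let $L=\sum_{r=1}^s I_{a_r}J_{b_r}\subset K[x_1,\dots,x_n,y_1,\dots,y_m]$, where the ideals $I_{a_r}$ in $K[x_1,\dots,x_n]$ and the ideals $J_{b_r}$ in $K[y_1,\dots,y_m]$ are squarefree Veronese ideals of degree $a_r$ and $b_r$, respectively (that is, $L$ is the generalized mixed product ideal induced by $I=(x^{a_1}y^{b_1},\dots,x^{a_s}y^{b_s})$ with these squarefree Veronese ideals). Assume that $a_s>\dots>a_1=1$ and $b_1>\dots>b_s=1$. If (1) $a_{r+1}=a_r+1$ for all $r=1,\dots,s-1$ and $b_{r-1}=b_r+1$ for all $r=2,\dots,s$, and (2) there is an integer $h$ with $2\le h\le m+n-1$ such that $a_r+b_r=h$ for all $r=1,\dots,s$, then $L$ has linear quotients.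
   Context: The squarefree Veronese ideal $I_a$ of degree $a$ in $K[x_1,\dots,x_n]$ is generated by all squarefree monomials of degree $a$ in $x_1,\dots,x_n$; $J_b$ is defined likewise in $K[y_1,\dots,y_m]$. Sums and products are formed in $K[x_1,\dots,x_n,y_1,\dots,y_m]$ after extending the ideals to that ring. A monomial ideal has linear quotients if its minimal monomial generators can be ordered $g_1,\dots,g_q$ such that for all $1\le i\le q-1$ the colon ideal $(g_1,\dots,g_i):g_{i+1}$ is generated by variables. *)

(* Defs.v *)
From HB Require Import structures.
From mathcomp Require Import all_boot all_order all_algebra.
From mathcomp Require Import mpoly.

Set Implicit Arguments.
Unset Strict Implicit.
Unset Printing Implicit Defensive.

Import GRing.Theory.
Local Open Scope ring_scope.

(* Subsets of a ring, in particular ideals, are Prop-valued predicates. *)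

Definition same_set (R : Type) (A B : R -> Prop) : Prop :=
  forall p, A p <-> B p.

Section Ideals.
Variable R : comNzRingType.
Implicit Types (S I J : R -> Prop).

(* Finite R-linear combinations of elements of S; in each pair, the first
   component is the coefficient. *)
Definition ideal_gen S : R -> Prop := fun p =>
  exists2 c : seq (R * R), (forall x, x \in c -> S x.2)
                         & p = \sum_(x <- c) x.1 * x.2.

Definition ideal_mul I J : R -> Prop :=
  ideal_gen (fun p => exists u v, [/\ I u, J v & p = u * v]).

Definition ideal_sum (s : nat) (I : nat -> R -> Prop) : R -> Prop := fun p =>
  exists2 u : nat -> R, (forall r, (1 <= r <= s)%N -> I r (u r))
                      & p = \sum_(1 <= r < s.+1) u r.

Definition colon I (g : R) : R -> Prop := fun p => I (p * g).

End Ideals.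

Definition ideal_ext (R S : comNzRingType) (f : R -> S) (I : R -> Prop) :
  S -> Prop := ideal_gen (fun q => exists2 p, I p & q = f p).

Section Monomials.
Variables (K : fieldType) (n : nat).
Implicit Types (I : {mpoly K[n]} -> Prop) (g : seq 'X_{1..n}).

Definition squarefree (u : 'X_{1..n}) : Prop := forall i, (u i <= 1)%N.

(* For n < a there is no such monomial, and the ideal is 0. *)
Definition squarefree_veronese (a : nat) : {mpoly K[n]} -> Prop :=
  ideal_gen (fun p =>
    exists u : 'X_{1..n}, [/\ squarefree u, mdeg u = a & p = 'X_[u]]).

Definition monomial_ideal g : {mpoly K[n]} -> Prop :=
  ideal_gen (fun p => exists2 u, u \in g & p = 'X_[u]).

(* g lists, without repetition, a set of monomials that generates I and is
   minimal under inclusion among such sets. *)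
Definition min_mon_gens I g : Prop :=
  [/\ uniq g,
      same_set I (monomial_ideal g)
    & forall g', {subset g' <= g} -> same_set I (monomial_ideal g') ->
        {subset g <= g'}].

Definition gen_by_variables I : Prop :=
  exists V : {set 'I_n},
    same_set I (ideal_gen (fun p => exists2 i, i \in V & p = 'X_i)).

(* Sequences are 0-based: take i g is (g_1, ..., g_i), nth _ g i is g_{i+1}. *)
Definition has_linear_quotients I : Prop :=
  exists2 g, min_mon_gens I g &
    forall i, (1 <= i <= (size g).-1)%N ->
      gen_by_variables (colon (monomial_ideal (take i g)) 'X_[nth 0%MM g i]).

End Monomials.

(* K[x_1..x_n, y_1..y_m] is {mpoly K[n + m]}, the x variables coming first. *)

Definition inclX (K : fieldType) (n m : nat) (p : {mpoly K[n]}) :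
  {mpoly K[n + m]} := p \mPo [tuple 'X_(lshift m i) | i < n].

Definition inclY (K : fieldType) (n m : nat) (p : {mpoly K[m]}) :
  {mpoly K[n + m]} := p \mPo [tuple 'X_(rshift n j) | j < m].

(* sum_{r=1}^s I_{a_r} J_{b_r} *)
Definition mixed_veronese (K : fieldType) (n m s : nat) (a b : nat -> nat) :
  {mpoly K[n + m]} -> Prop :=
  ideal_sum s (fun r =>
    ideal_mul (ideal_ext (@inclX K n m) (@squarefree_veronese K n (a r)))
              (ideal_ext (@inclY K n m) (@squarefree_veronese K m (b r)))).
Arguments mixed_veronese : clear implicits.

(* Main.v *)
Require Import Defs.
From mathcomp Require Import all_boot all_order all_algebra.
From mathcomp Require Import mpoly.

Set Implicit Arguments.
Unset Strict Implicit.
Unset Printing Implicit Defensive.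

Import Order.TTheory GRing.Theory.
Local Open Scope ring_scope.

(** The hypotheses force [a r = r] and [b r = h - r] for [1 <= r <= s], with
    [s = h - 1].  Hence the products of generators of the summands are exactly
    the squarefree monomials of degree [h] in all [n + m] variables that
    involve at least one x and at least one y ([mixed_veroneseE]).  Identify
    such a monomial with its support: the supports are the [h]-subsets of the
    set of variables that meet both blocks of the bipartition into x's and
    y's.

    These subsets satisfy the dual basis exchange axiom of matroids: if A and
    B are two of them and j lies in A but not in B, some k in B but not in A
    can be traded for j, so that B - k + j is again of this kind
    ([crossing_coexchange]).  Only the block that does not contain j can be
    lost in the trade, and if every k in B \ A lost it, then B \ A would be
    a single element, and B - k + j would be A itself, which meets both blocks.

    A squarefree monomial ideal generated in one degree whose supports have
    this exchange property has linear quotients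
    ([coexchange_linear_quotients]).  List the generators in decreasing
    lexicographic order.  If x^A comes before x^B, let j be the first variable
    at which they differ; it lies in A \ B, and the exchanged k lies after j.
    So x^(B - k + j) also comes before x^B, it divides x^B * x_j, and x_j
    divides x^A / gcd(x^A, x^B).  The colon ideal is therefore generated by
    variables, by the criterion [colon_monomial_gen]. *)

(** * Ideals given by generators *)

Definition is_ideal (R : comNzRingType) (I : R -> Prop) : Prop :=
  [/\ I 0, forall p q, I p -> I q -> I (p + q) & forall c p, I p -> I (c * p)].

Section IdealTheory.
Variable R : comNzRingType.
Implicit Types (S T I J : R -> Prop).

Lemma is_ideal_sum (A : eqType) I (s : seq A) (F : A -> R) :
  is_ideal I -> (forall x, x \in s -> I (F x)) -> I (\sum_(x <- s) F x).
Proof.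
case=> I0 ID _ IF; rewrite big_seq.
by apply: (big_ind I) => // x /IF.
Qed.

Lemma ideal_gen_is_ideal S : is_ideal (ideal_gen S).
Proof.
split=> [|p q [c cS ->] [d dS ->]|a p [c cS ->]].
- by exists [::]; rewrite ?big_nil.
- exists (c ++ d); last by rewrite big_cat.
  by move=> x; rewrite mem_cat => /orP[/cS|/dS].
- exists [seq (a * x.1, x.2) | x <- c].
    by move=> _ /mapP[x /cS Sx ->].
  by rewrite big_map mulr_sumr; apply: eq_bigr => x _; rewrite mulrA.
Qed.

Lemma mem_ideal_gen S p : S p -> ideal_gen S p.
Proof.
move=> Sp; exists [:: (1, p)]; last by rewrite big_seq1 mul1r.
by move=> x /[!inE] /eqP ->.
Qed.

Lemma ideal_gen_min S I :
  is_ideal I -> (forall p, S p -> I p) -> forall p, ideal_gen S p -> I p.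
Proof.
move=> idI SI p [c cS ->]; apply: is_ideal_sum => // x /cS /SI Ix.
by case: idI => _ _; apply.
Qed.

Lemma colon_is_ideal I g : is_ideal I -> is_ideal (colon I g).
Proof.
rewrite /colon => -[I0 ID IM]; split=> [|p q Ip Iq|c p Ip].
- by rewrite mul0r.
- by rewrite mulrDl; apply: ID.
- by rewrite -mulrA; apply: IM.
Qed.

Lemma preimage_is_ideal (A : comNzRingType) (f : {rmorphism A -> R}) I :
  is_ideal I -> is_ideal (fun p => I (f p)).
Proof.
case=> I0 ID IM; split=> [|p q Ip Iq|c p Ip].
- by rewrite rmorph0.
- by rewrite rmorphD; apply: ID.
- by rewrite rmorphM; apply: IM.
Qed.

Lemma ideal_sum_is_ideal s (I : nat -> R -> Prop) :
  (forall r, (1 <= r <= s)%N -> is_ideal (I r)) -> is_ideal (ideal_sum s I).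
Proof.
move=> idI; split=> [|p q [u uI ->] [v vI ->]|c p [u uI ->]].
- exists (fun=> 0); last by rewrite big1_eq.
  by move=> r /idI [].
- exists (fun r => u r + v r); last by rewrite big_split.
  by move=> r rs; have [_ ID _] := idI r rs; apply: ID; [apply: uI | apply: vI].
- exists (fun r => c * u r); last by rewrite mulr_sumr.
  by move=> r rs; have [_ _ IM] := idI r rs; apply/IM/uI.
Qed.

Lemma mem_ideal_sum s (I : nat -> R -> Prop) r p :
    (forall t, (1 <= t <= s)%N -> is_ideal (I t)) ->
  (1 <= r <= s)%N -> I r p -> ideal_sum s I p.
Proof.
move=> idI rs Ip; exists (fun t => if t == r then p else 0).
  by move=> t /idI [I0 _ _]; case: eqP => [->|].
rewrite (bigD1_seq r) ?iota_uniq ?mem_index_iota //= eqxx.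
by rewrite big1 ?addr0 // => t /negbTE->.
Qed.

Lemma ideal_sum_min s (I : nat -> R -> Prop) J :
    is_ideal J -> (forall r p, (1 <= r <= s)%N -> I r p -> J p) ->
  forall p, ideal_sum s I p -> J p.
Proof.
move=> idJ IJ _ [u uI ->]; apply: is_ideal_sum => // r.
by rewrite mem_index_iota ltnS => rs; apply: IJ (uI r rs).
Qed.

End IdealTheory.

Lemma ideal_ext_gen (A R : comNzRingType) (f : {rmorphism A -> R})
    (S : A -> Prop) :
  forall q, ideal_ext f (ideal_gen S) q ->
    ideal_gen (fun q => exists2 p, S p & q = f p) q.
Proof.
apply: ideal_gen_min (ideal_gen_is_ideal _) _ => _ [p Sp ->].
have idf := preimage_is_ideal f
  (ideal_gen_is_ideal (fun q => exists2 p, S p & q = f p)).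
apply: (ideal_gen_min idf _ Sp) => x Sx.
by apply: mem_ideal_gen; exists x.
Qed.

(** To bound a product of extended ideals it is enough to bound the products of
    generators: fixing one factor, the other ranges over a colon ideal. *)
Lemma ideal_mul_ext_min (A B R : comNzRingType) (f : {rmorphism A -> R})
    (g : {rmorphism B -> R}) (S : A -> Prop) (T : B -> Prop) (I : R -> Prop) :
    is_ideal I -> (forall p q, S p -> T q -> I (f p * g q)) ->
  forall p,
    ideal_mul (ideal_ext f (ideal_gen S)) (ideal_ext g (ideal_gen T)) p -> I p.
Proof.
move=> idI STI; apply: ideal_gen_min => // _ [u [v [Su Tv ->]]].
apply: (ideal_gen_min (colon_is_ideal v idI) _ (ideal_ext_gen Su)).
move=> _ [p Sp ->]; rewrite /colon mulrC.
apply: (ideal_gen_min (colon_is_ideal (f p) idI) _ (ideal_ext_gen Tv)).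
by move=> _ [q Tq ->]; rewrite /colon mulrC; apply: STI.
Qed.

(** * Monomial ideals *)

Section MonomialIdeals.
Variables (K : fieldType) (n : nat).
Implicit Types (P : 'X_{1..n} -> Prop) (p : {mpoly K[n]}) (g : seq 'X_{1..n}).

(** A monomial ideal contains a polynomial as soon as it contains the monomials
    of its support; this turns ideal membership into divisibility. *)
Lemma mem_monomial_gen P p :
  ideal_gen (fun q => exists2 u, P u & q = 'X_[u]) p <->
  forall m, m \in msupp p -> exists2 u, P u & (u <= m)%MM.
Proof.
split.
  move: p; apply: ideal_gen_min => [|_ [u Pu ->]]; last first.
    by move=> m /[!(msuppX, inE)] /eqP ->; exists u; rewrite ?lepm_refl.
  split=> [m|p q Ip Iq m|c p Ip m]; first by rewrite msupp0.
    by move/msuppD_le; rewrite mem_cat => /orP[/Ip|/Iq].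
  move/msuppM_le/allpairsP => -[[m1 m2] /= [_ /Ip [u Pu le_um] ->]].
  by exists u => //; apply: lepm_trans le_um (lem_addl _ _).
move=> Pp; rewrite (mpolyE p); apply: is_ideal_sum => [|m /Pp[u Pu le_um]].
  exact: ideal_gen_is_ideal.
rewrite -(submK le_um) mpolyXD -mul_mpolyC mulrA.
have [_ _ IM] := ideal_gen_is_ideal
  (fun q : {mpoly K[n]} => exists2 u, P u & q = 'X_[u]).
by apply/IM/mem_ideal_gen; exists u.
Qed.

(** The quotients u / gcd(u, b), for u in [g], generate the colon ideal.  The
    hypothesis says that each of them is divisible by a variable that itself
    lies in the colon ideal. *)
Lemma colon_monomial_gen g (b : 'X_{1..n}) :
    (forall u, u \in g -> exists2 j, (b j < u j)%N &
       exists2 w, w \in g & (w <= b + U_(j))%MM) ->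
  gen_by_variables (colon (@monomial_ideal K n g) 'X_[b]).
Proof.
move=> gP.
pose V : {set 'I_n} := [set j | has (fun w => (w <= b + U_(j))%MM) g].
exists V => p; transitivity (forall m, m \in msupp p ->
  exists2 u, (exists2 i, i \in V & u = U_(i)%MM) & (u <= m)%MM); last first.
  rewrite -mem_monomial_gen; split.
    apply: ideal_gen_min (ideal_gen_is_ideal _) _ p => _ [_ [i Vi ->] ->].
    by apply: mem_ideal_gen; exists i.
  apply: ideal_gen_min (ideal_gen_is_ideal _) _ p => _ [i Vi ->].
  by apply: mem_ideal_gen; exists U_(i)%MM => //; exists i.
rewrite /colon /monomial_ideal mem_monomial_gen; split=> [Ip m mp|Vp m].
  have [|u /gP[j ltbu [w wg le_w]] /mnm_lepP/(_ j)] := Ip (b + m)%MM.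
    by rewrite (perm_mem (msuppMX _ _)) map_f.
  rewrite mnmDE => /(leq_trans ltbu); rewrite -[X in (X < _)%N]addn0 ltn_add2l.
  move=> mj_gt0; exists U_(j)%MM; last by rewrite lep1mP -lt0n.
  by exists j => //; rewrite inE; apply/hasP; exists w.
rewrite (perm_mem (msuppMX _ _)) => /mapP[{}m /Vp[_ [j Vj ->] le_jm] ->].
move: Vj; rewrite inE => /hasP[w wg le_w]; exists w => //.
apply: lepm_trans le_w _; apply/mnm_lepP=> l.
by rewrite !mnmDE leq_add2l; apply/mnm_lepP: l.
Qed.

(** Between monomials of equal degree, divisibility is equality, so none of
    them is redundant. *)
Lemma equidegree_min_mon_gens (d : nat) (I : {mpoly K[n]} -> Prop) g :
    uniq g -> (forall u, u \in g -> mdeg u = d) ->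
    same_set I (@monomial_ideal K n g) ->
  min_mon_gens I g.
Proof.
move=> g_uniq g_deg Ig; split=> // g' sub_g' Ig' u ug.
have : @monomial_ideal K n g' 'X_[u].
  by apply/Ig'/Ig/mem_ideal_gen; exists u.
move/mem_monomial_gen/(_ u); rewrite msuppX inE eqxx.
case=> // v vg' le_vu.
rewrite -(submK le_vu); suff /eqP: mdeg (u - v)%MM = 0%N.
  by rewrite mdeg_eq0 => /eqP ->; rewrite add0m.
have := congr1 (@mdeg n) (submK le_vu).
rewrite mdegD (g_deg _ ug) (g_deg _ (sub_g' _ vg')) => /eqP.
by rewrite -{2}(add0n d) eqn_add2r => /eqP.
Qed.

End MonomialIdeals.

(** * Lexicographic linear quotients from the exchange property *)

(** The dual form of the basis exchange axiom: the element [j] that enters [B]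
    is prescribed, the element [k] that leaves it is not. *)
Definition coexchange (T : finType) (F : {set {set T}}) : Prop :=
  forall A B j, A \in F -> B \in F -> j \in A :\: B ->
    exists2 k, k \in B :\: A & j |: B :\ k \in F.

(** In a strictly decreasing list, being listed before the i-th element is being
    larger; this replaces positions by comparisons of monomials. *)
Lemma mem_take_sorted_gt (d : Order.disp_t) (T : porderType d) (x0 : T)
    (s : seq T) i u :
    sorted >%O s -> (i < size s)%N ->
  (u \in take i s) = (u \in s) && (nth x0 s i < u)%O.
Proof.
move=> s_sorted i_lt; rewrite in_take_leq ?(ltnW i_lt) //.
have [us|u_notin] := boolP (u \in s); last first.
  by rewrite memNindex // ltnNge (ltnW i_lt).
have idx_lt : (index u s < size s)%N by rewrite index_mem.
rewrite -{2}(nth_index x0 us) /=.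
have gt_nth : {in gtn (size s) &,
    {homo nth x0 s : i j / (i < j)%N >-> (j < i)%O}}.
  move=> a b ainE binE ab.
  by apply: (sorted_ltn_nth (rev_trans lt_trans)).
have [lt_ui|lt_iu|->] := ltngtP (index u s) i; last by rewrite ltxx.
  by rewrite gt_nth.
by apply/esym/negbTE; rewrite lt_gtF // gt_nth.
Qed.

Section Exchange.
Variables (K : fieldType) (n : nat).

(** Monomials are compared by degree, then lexicographically with the variable
    of smallest index dominating, so the first index at which two supports
    differ belongs to the larger monomial. *)
Lemma coexchange_linear_quotients (d : nat) (F : {set {set 'I_n}})
    (I : {mpoly K[n]} -> Prop) :
    (forall A, A \in F -> #|A| = d) -> coexchange F ->
    same_set I (@monomial_ideal K n [seq mesym1 A | A in F]) ->
  has_linear_quotients I.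
Proof.
move=> F_card F_exch IF.
pose g := rev (sort <=%O [seq mesym1 A | A in F]).
have gP u : reflect (exists2 A, A \in F & u = mesym1 A) (u \in g).
  rewrite mem_rev mem_sort; apply: (iffP mapP) => -[A AF ->]; exists A => //.
    by rewrite mem_enum in AF.
  by rewrite mem_enum.
have g_uniq : uniq g by rewrite rev_uniq sort_uniq map_inj_uniq ?enum_uniq //;
  apply: inj_mesym1.
have g_sorted : sorted >%O g.
  by rewrite rev_sorted sort_lt_sorted -(sort_uniq <=%O) -rev_uniq.
exists g.
  apply: (@equidegree_min_mon_gens _ _ d) => // [_ /gP[A AF ->]|p].
    by rewrite mdeg_mesym1 F_card.
  rewrite IF /monomial_ideal !mem_monomial_gen.
  by split=> H m /H [u ug le_um]; exists u;
    rewrite // ?mem_rev ?mem_sort // mem_rev mem_sort in ug *.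
move=> i /andP[i_gt0 i_le].
have {i_gt0 i_le} i_lt : (i < size g)%N.
  by case: (size g) i_le => //; case: i i_gt0.
apply: colon_monomial_gen => u; rewrite (mem_take_sorted_gt 0%MM) //.
have /gP[B BF defB] : nth 0%MM g i \in g by rewrite mem_nth.
rewrite defB.
case/andP=> /gP[A AF ->] /ltmcP.
rewrite !mdeg_mesym1 !F_card // => /(_ erefl) [j agree lt_j]; exists j => //.
have jAB : j \in A :\: B.
  by move: lt_j; rewrite !mnmE inE; do 2 case: (_ \in _).
have [k kBA CF] := F_exch A B j AF BF jAB.
(* [A] and [B] agree below [j], hence lowering the exponent of [k] does not
   affect the comparison with [B], which is decided at [j]. *)
have kj : ~~ (k < j)%N.
  apply/negP=> /agree; move: kBA; rewrite !mnmE inE.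
  by case/andP=> /negbTE-> ->.
exists (mesym1 (j |: B :\ k)).
  rewrite (mem_take_sorted_gt 0%MM) // defB.
  apply/andP; split; first by apply/gP; exists (j |: B :\ k).
  move: jAB kBA; rewrite !inE => /andP[jB jA] /andP[kA kB].
  apply/ltmcP; first by rewrite !mdeg_mesym1 !F_card.
  exists j; last by rewrite !mnmE !inE eqxx (negbTE jB).
  move=> l lj; rewrite !mnmE !inE.
  have -> : (l == j) = false by rewrite -val_eqE ltn_eqF.
  by have /negbTE-> : l != k by apply: contraNneq kj => <-.
apply/mnm_lepP=> l; rewrite mnmDE mnm1E !mnmE !inE [l == j]eq_sym.
by case: (j == l); case: (l \in B); case: (l == k).
Qed.

End Exchange.

(** * Sets of given size meeting both blocks of a bipartition *)

Section Bipartition.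
Variable T : finType.
Implicit Types (A B P Q : {set T}).

Definition crossing (h : nat) P : {set {set T}} :=
  [set A : {set T} | [&& #|A| == h, A :&: P != set0 & A :&: ~: P != set0]].

(** Adding [j] cannot help [B] to meet [Q], so [k] must not be the only point
    of [B] in [Q].  Take a point [z] of [A] in [Q].  If [z] is in [B], it
    survives any exchange.  Otherwise [z] and [j] are two points of [A :\: B],
    so [B :\: A] has two points as well, and one of them differs from a given
    point of [B] in [Q]. *)
Lemma exchange_keeping_meet A B Q j :
    #|A| = #|B| -> j \in A :\: B -> j \notin Q ->
    A :&: Q != set0 -> B :&: Q != set0 ->
  exists2 k, k \in B :\: A & (B :\ k) :&: Q != set0.
Proof.
move=> cardAB jAB jQ /set0Pn[z /setIP[zA zQ]] /set0Pn[q /setIP[qB qQ]].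
have cardD : #|B :\: A| = #|A :\: B|.
  by rewrite !cardsD cardAB setIC.
have [k kBA kq] : exists2 k, k \in B :\: A &
    exists2 q', q' != k & q' \in B :&: Q.
  have [zB|zB] := boolP (z \in B).
    have : (0 < #|B :\: A|)%N by rewrite cardD; apply/card_gt0P; exists j.
    case/card_gt0P=> k kBA; exists k => //; exists z; last by rewrite inE zB.
    by apply: contraTneq zA => ->; move: kBA; rewrite inE => /andP[].
  have : (1 < #|B :\: A|)%N.
    rewrite cardD (cardD1 j) jAB ltnS; apply/card_gt0P; exists z.
    by rewrite !inE zA zB !andbT; apply: contraNneq jQ => <-.
  case/card_gt1P=> k [k' [kBA k'BA neq_kk']].
  have [eq_qk|neq_qk] := eqVneq q k.
    by exists k' => //; exists q; rewrite ?inE ?qB // eq_qk.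
  by exists k => //; exists q; rewrite ?inE ?qB.
case: kq => q' q'k /setIP[q'B q'Q]; exists k => //.
by apply/set0Pn; exists q'; rewrite !inE q'k q'B.
Qed.

(** The block containing [j] is met by [j] itself, so only the other block
    needs care. *)
Lemma crossing_coexchange h P : coexchange (crossing h P).
Proof.
move=> A B j AF BF jAB; move: AF BF.
rewrite !inE => /and3P[/eqP cA AP AP'] /and3P[/eqP cB BP BP'].
have swap_in Q : j \in Q -> forall k, (j |: B :\ k) :&: Q != set0.
  by move=> jQ k; apply/set0Pn; exists j; rewrite !inE eqxx jQ.
have swap_meet Q k : (B :\ k) :&: Q != set0 -> (j |: B :\ k) :&: Q != set0.
  by apply: subset_neq0; rewrite setSI ?subsetUr.
have swap_card k : k \in B :\: A -> #|j |: B :\ k| == h.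
  rewrite inE => /andP[_ kB]; have /andP[jB _] : (j \notin B) && (j \in A).
    by rewrite inE in jAB.
  by rewrite cardsU1 !inE (negbTE jB) andbF -cB (cardsD1 k B) kB.
have cardAB : #|A| = #|B| by rewrite cA.
have [jP|jP] := boolP (j \in P).
  have jP' : j \notin ~: P by rewrite inE jP.
  have [k kBA Bk] := exchange_keeping_meet cardAB jAB jP' AP' BP'.
  by exists k; rewrite // inE swap_card // swap_in // swap_meet.
have [k kBA Bk] := exchange_keeping_meet cardAB jAB jP AP BP.
by exists k; rewrite // inE swap_card // swap_meet // swap_in // inE.
Qed.

End Bipartition.

(** * Generators of the mixed product ideal *)

Definition xblock (n m : nat) : {set 'I_(n + m)} :=
  [set lshift m i | i : 'I_n].

Section MixedProduct.
Variables (K : fieldType) (n m : nat).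

Definition paste (u : 'X_{1..n}) (v : 'X_{1..m}) : 'X_{1..n + m} :=
  [multinom match split k with inl i => u i | inr j => v j end | k < n + m].

Lemma paste_lshift u v i : paste u v (lshift m i) = u i.
Proof. by rewrite mnmE (unsplitK (inl i)). Qed.

Lemma paste_rshift u v j : paste u v (rshift n j) = v j.
Proof. by rewrite mnmE (unsplitK (inr j)). Qed.

Lemma inclM_paste u v :
  @inclX K n m 'X_[u] * @inclY K n m 'X_[v] = 'X_[paste u v].
Proof.
rewrite /inclX /inclY !comp_mpolyX (mpolyXE_id _ (paste u v)) big_split_ord /=.
by congr (_ * _); apply: eq_bigr => i _;
  rewrite tnth_mktuple ?paste_lshift ?paste_rshift.
Qed.

Lemma paste_mesym1 (A : {set 'I_(n + m)}) :
  mesym1 A = paste (mesym1 (lshift m @^-1: A)) (mesym1 (@rshift n m @^-1: A)).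
Proof.
apply/mnmP=> k; rewrite -(splitK k).
by case: (split k) => i /=; rewrite ?paste_lshift ?paste_rshift !mnmE inE.
Qed.

Lemma squarefree_mesym1 (N : nat) (A : {set 'I_N}) : squarefree (mesym1 A).
Proof. by move=> i; rewrite mnmE leq_b1. Qed.

Lemma squarefreeE (N : nat) (u : 'X_{1..N}) :
  squarefree u -> u = mesym1 [set i | u i != 0%N].
Proof.
move=> sq_u; apply/mnmP=> i; rewrite mnmE inE.
by have := sq_u i; case: (u i) => [|[|]].
Qed.

Lemma card_xblockI (A : {set 'I_(n + m)}) :
  #|A :&: xblock n m| = #|lshift m @^-1: A|.
Proof.
rewrite -(card_imset _ (@lshift_inj n m)); apply: eq_card => k.
rewrite inE; apply/andP/imsetP => [[kA /imsetP[i _ def_k]]|[i iA ->]].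
  by exists i; rewrite // inE -def_k.
by split; [rewrite inE in iA | apply: imset_f].
Qed.

Lemma card_yblockI (A : {set 'I_(n + m)}) :
  #|A :&: ~: xblock n m| = #|@rshift n m @^-1: A|.
Proof.
rewrite -(card_imset _ (@rshift_inj n m)); apply: eq_card => k.
rewrite !inE; apply/andP/imsetP => [[kA kX]|[j jA ->]]; last first.
  rewrite inE in jA; split=> //; apply/imsetP=> -[i _ /eqP].
  by rewrite eq_rlshift.
move: kA kX; rewrite -(splitK k); case: (split k) => i /= kA.
  by rewrite imset_f.
by move=> _; exists i; rewrite // inE.
Qed.

(** A monomial of the product ring splits uniquely into an x-part and a y-part.
    When [a] takes every value strictly between 0 and [h], any splitting of the
    degree [h] into two positive parts is realized by some summand. *)
Lemma mixed_veroneseE s a b h :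
    (forall r, (1 <= r <= s)%N ->
       [/\ (0 < a r)%N, (0 < b r)%N & a r + b r = h]%N) ->
    (forall d, (0 < d < h)%N -> exists2 r, (1 <= r <= s)%N & a r = d) ->
  same_set (@mixed_veronese K n m s a b)
    (monomial_ideal [seq mesym1 A | A in crossing h (xblock n m)]).
Proof.
move=> ab a_onto p.
have idr r : (1 <= r <= s)%N -> is_ideal (ideal_mul
    (ideal_ext (@inclX K n m) (@squarefree_veronese K n (a r)))
    (ideal_ext (@inclY K n m) (@squarefree_veronese K m (b r)))).
  by move=> _; apply: ideal_gen_is_ideal.
split.
  move: p; apply: ideal_sum_min (ideal_gen_is_ideal _) _ => r p rs.
  apply: (@ideal_mul_ext_min _ _ _ (comp_mpoly [tuple 'X_(lshift m i) | i < n])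
    (comp_mpoly [tuple 'X_(rshift n j) | j < m])); first exact: ideal_gen_is_ideal.
  have [a_gt0 b_gt0 abh] := ab r rs.
  move=> _ _ [u [sq_u deg_u ->]] [v [sq_v deg_v ->]].
  apply: mem_ideal_gen; exists (paste u v); last exact: inclM_paste.
  have [A defA] : exists A, paste u v = mesym1 A.
    exists [set k | paste u v k != 0%N]; apply: squarefreeE => k.
    rewrite -(splitK k); case: (split k) => i /=.
      by rewrite paste_lshift.
    by rewrite paste_rshift; apply: sq_v.
  have uA : u = mesym1 (lshift m @^-1: A).
    apply/mnmP=> i; move/mnmP/(_ (lshift m i)): defA.
    by rewrite paste_lshift => ->; rewrite !mnmE inE.
  have vA : v = mesym1 (@rshift n m @^-1: A).
    apply/mnmP=> j; move/mnmP/(_ (rshift n j)): defA.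
    by rewrite paste_rshift => ->; rewrite !mnmE inE.
  rewrite defA; apply: map_f; rewrite mem_enum inE -!card_gt0.
  rewrite -(cardsID (xblock n m) A) setDE card_xblockI card_yblockI.
  by rewrite -!mdeg_mesym1 -uA -vA deg_u deg_v abh eqxx a_gt0 b_gt0.
move: p; apply: ideal_gen_min (ideal_sum_is_ideal idr) _.
move=> _ [_ /imageP[A AF ->] ->].
move: AF; rewrite inE -!card_gt0 => /and3P[/eqP].
rewrite -(cardsID (xblock n m) A) setDE card_xblockI card_yblockI.
set A1 := lshift m @^-1: A; set A2 := @rshift n m @^-1: A => cA A1_gt0 A2_gt0.
have A1_lt : (0 < #|A1| < h)%N by rewrite A1_gt0 -cA -addn1 leq_add2l.
have [r rs ar] := a_onto _ A1_lt.
apply: (mem_ideal_sum idr rs); rewrite paste_mesym1 -inclM_paste.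
have [_ _ abh] := ab r rs.
have br : b r = #|A2| by apply/eqP; rewrite -(eqn_add2l (a r)) abh ar cA.
apply: mem_ideal_gen.
exists (@inclX K n m 'X_[mesym1 A1]), (@inclY K n m 'X_[mesym1 A2]); split=> //.
  apply: mem_ideal_gen; exists 'X_[mesym1 A1] => //; apply: mem_ideal_gen.
  by exists (mesym1 A1); rewrite mdeg_mesym1 ar; split=> //; apply: squarefree_mesym1.
apply: mem_ideal_gen; exists 'X_[mesym1 A2] => //; apply: mem_ideal_gen.
by exists (mesym1 A2); rewrite mdeg_mesym1 br; split=> //; apply: squarefree_mesym1.
Qed.

End MixedProduct.

Theorem theorem3p1 (K : fieldType) (m n : nat) (hm : (1 < m)%N) (hn : (1 < n)%N)
  (s : nat) (hs : (1 <= s)%N) (a b : nat -> nat)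
  (a_incr : forall r t : nat, (1 <= r)%N -> (r < t)%N -> (t <= s)%N ->
     (a r < a t)%N)
  (a_first : a 1%N = 1%N)
  (b_decr : forall r t : nat, (1 <= r)%N -> (r < t)%N -> (t <= s)%N ->
     (b t < b r)%N)
  (b_last : b s = 1%N)
  (a_step : forall r : nat, (1 <= r <= s.-1)%N -> a r.+1 = (a r).+1)
  (b_step : forall r : nat, (2 <= r <= s)%N -> b r.-1 = (b r).+1)
  (h : nat) (h_bounds : (2 <= h <= m + n - 1)%N)
  (ab_sum : forall r : nat, (1 <= r <= s)%N -> (a r + b r)%N = h) :
  has_linear_quotients (mixed_veronese K n m s a b).
Proof.
have a_id r : (1 <= r <= s)%N -> a r = r.
  elim: r => // -[|r] IHr /= rs; first exact: a_first.
  have r_lt : (r.+1 <= s.-1)%N by rewrite -ltnS prednK.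
  by rewrite a_step ?r_lt // IHr // (ltnW rs).
have def_h : h = s.+1.
  by rewrite -(ab_sum s) ?hs ?leqnn // a_id ?hs ?leqnn // b_last addn1.
apply: (coexchange_linear_quotients (d := h) _
  (@crossing_coexchange _ h (xblock n m))).
  by move=> A; rewrite inE => /andP[/eqP].
apply: mixed_veroneseE => [r rs|d]; last first.
  by rewrite def_h ltnS => ds; exists d; rewrite ?a_id.
split; [| |exact: ab_sum]; first by rewrite a_id //; case/andP: rs.
have /andP[_ rs'] := rs.
by rewrite lt0n; apply/eqP => br0; move: (ab_sum r rs);
  rewrite br0 addn0 a_id // def_h => eq_r; rewrite eq_r ltnn in rs'.
Qed.
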